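(* Let $k$ be even and let $G=(V,E)$ be a $k$-uniform hypergraph with maximum degree $d>0$. Let $\mathcal L$ be the Laplacian tensor of $G$. Then $\lambda(\mathcal L)$ is not smaller than the unique real root of the equation $(1-\lambda)^{k-1}(\lambda-d)+d=0$ in the interval $(d,d+1)$.
   Context: Hypergraphs are undirected, simple, $k$-uniform ($k\ge 3$, every edge has exactly $k$ vertices), with vertex set $V=[n]=\{1,\dots,n\}$, $n\ge k$, and nonempty edge set $E$. The degree $d_i$ of vertex $i$ is the number of edges containing $i$. The adjacency tensor $\mathcal A$ is the $k$-th order $n$-dimensional tensor with $a_{i_1\dots i_k}=\frac1{(k-1)!}$ if $\{i_1,\dots,i_k\}\in E$ and $0$ otherwise; $\mathcal D$ is the diagonal tensor with diagonal entries $d_{i\dots i}=d_i$; the Laplacian tensor is $\mathcal L=\mathcal D-\mathcal A$. For a tensor $\mathcal T=(t_{i_1\dots i_k})$ and $\mathbf x\in\mathbb R^n$, $(\mathcal T\mathbf x^{k-1})_i=\sum_{i_2,\dots,i_k\in[n]}t_{ii_2\dots i_k}x_{i_2}\cdots x_{i_k}$; thus $(\mathcal L\mathbf x^{k-1})_i=d_ix_i^{k-1}-\sum_{e\in E,\,i\in e}\prod_{j\in e\setminus\{i\}}x_j$. A real number $\lambda$ is an H-eigenvalue of $\mathcal T$ with H-eigenvector $\mathbf x\in\mathbb R^n\setminus\{0\}$ if $(\mathcal T\mathbf x^{k-1})_i=\lambda x_i^{k-1}$ for all $i\in[n]$. $\lambda(\mathcal T)$ denotes the largest H-eigenvalue of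 $\mathcal T$ (it exists for the tensors considered here).
   Formalization: For d = 1 the equation reads 1-(λ-1)^k = 0 and has no root in the open interval (1,2), so in that case only the interval is taken as (d,d+1], with root λ = 2; for d ≥ 2 the interval is (d,d+1) as stated. *)

(* Defs.v *)
From mathcomp Require Import all_boot all_order all_algebra.
From mathcomp Require Import all_classical all_reals.

Set Implicit Arguments.
Unset Strict Implicit.
Unset Printing Implicit Defensive.

Import Order.TTheory GRing.Theory Num.Theory.
Local Open Scope classical_set_scope.
Local Open Scope ring_scope.

Definition uniform_hypergraph (k n : nat) (E : {set {set 'I_n}}) : Prop :=
  E != finset.set0 /\ forall e : {set 'I_n}, e \in E -> #|e| = k.

Definition degree (n : nat) (E : {set {set 'I_n}}) (i : 'I_n) : nat :=
  #|[set e in E | i \in e]%SET|.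

Definition max_degree (n : nat) (E : {set {set 'I_n}}) : nat :=
  (\max_(i < n) degree E i)%N.

(* A tensor of order k >= 1: [T i t] is the entry t_{i i_2 ... i_k}, where [t] *)
(* lists the k - 1 indices i_2, ..., i_k.                                      *)
Definition tensor (R : Type) (k n : nat) : Type :=
  'I_n -> k.-1.-tuple 'I_n -> R.

Definition tensor_apply (R : realType) (k n : nat) (T : tensor R k n)
    (x : 'rV[R]_n) : 'rV[R]_n :=
  \row_i \sum_(t : k.-1.-tuple 'I_n) T i t * \prod_(j <- t) x 0 j.

Definition H_eigenvalue (R : realType) (k n : nat) (T : tensor R k n)
    (lam : R) : Prop :=
  exists2 x : 'rV[R]_n, x != 0 &
    forall i : 'I_n, tensor_apply T x 0 i = lam * x 0 i ^+ k.-1.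

Definition largest_H_eigenvalue_spec (R : realType) (k n : nat)
    (T : tensor R k n) (lam : R) : Prop :=
  H_eigenvalue T lam /\ forall mu : R, H_eigenvalue T mu -> mu <= lam.

(* The value is 0 when no largest H-eigenvalue exists; in particular a positive *)
(* lower bound on it entails that a largest H-eigenvalue exists.                *)
Definition largest_H_eigenvalue (R : realType) (k n : nat)
    (T : tensor R k n) : R :=
  xget 0 [set lam | largest_H_eigenvalue_spec T lam].

Lemma largest_H_eigenvalueE (R : realType) (k n : nat) (T : tensor R k n)
    (lam : R) :
  largest_H_eigenvalue_spec T lam -> largest_H_eigenvalue T = lam.
Proof.
move=> lamP; apply: xget_unique => //= mu muP.
by apply/eqP; rewrite eq_le lamP.2 ?muP.2 //; [exact: lamP.1 | exact: muP.1].
Qed.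

(* When all edges have k elements, the set of indices is an edge only if the k *)
(* indices are pairwise distinct.                                              *)
Definition adjacency_tensor (R : realType) (k n : nat)
    (E : {set {set 'I_n}}) : tensor R k n :=
  fun i t => if [set j in i :: t]%SET \in E then ((k.-1)`!%:R)^-1 else 0.
Arguments adjacency_tensor R k {n} E i t.

Definition degree_tensor (R : realType) (k n : nat)
    (E : {set {set 'I_n}}) : tensor R k n :=
  fun i t => if all (pred1 i) t then (degree E i)%:R else 0.
Arguments degree_tensor R k {n} E i t.

Definition laplacian_tensor (R : realType) (k n : nat)
    (E : {set {set 'I_n}}) : tensor R k n :=
  fun i t => degree_tensor R k E i t - adjacency_tensor R k E i t.
Arguments laplacian_tensor R k {n} E i t.

(* Main.v *)
(* For even k, x L x^(k-1) is the form [laplacian_form], and its maximum relative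
   to sum_i x_i^k is attained; the maximum condition in each coordinate is the
   eigenvalue equation, so the maximum is the largest H-eigenvalue.  With mu the
   root, test the form on the vector equal to 1 - mu at a vertex s of maximum
   degree d, to 1 on the neighbours of s and to 0 elsewhere.  Edges avoiding s
   contribute nonnegatively, and s has at most d(k-1) neighbours, so the quotient
   is at least its value when the edges at s share only s.  There the vector is
   an eigenvector of the hyperstar, and the value is mu. *)
Require Import Defs.
From mathcomp Require Import all_boot all_order all_algebra.
From mathcomp Require Import all_classical all_reals.
From mathcomp Require Import topology normedtype derive realfun.
From mathcomp Require Import ring lra.

Set Implicit Arguments.
Unset Strict Implicit.
Unset Printing Implicit Defensive.

Import Order.TTheory GRing.Theory Num.Theory.
Import numFieldNormedType.Exports.
Local Open Scope ring_scope.

(** * The two homogeneous forms and a first-order condition *)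

Definition power_sum (R : realType) (k n : nat) (x : 'rV[R]_n) : R :=
  \sum_i x 0 i ^+ k.

(** Each edge contributes [k] times its gap in the inequality of arithmetic and geometric means for
    the numbers x_i^k when x is nonnegative. *)
Definition laplacian_form (R : realType) (k n : nat) (E : {set {set 'I_n}})
    (x : 'rV[R]_n) : R :=
  \sum_(e in E) (\sum_(i in e) x 0 i ^+ k - k%:R * \prod_(i in e) x 0 i).

Lemma deriv_at_min (R : realType) (p : {poly R}) (y : R) :
  (forall s, p.[y] <= p.[s]) -> p^`().[y] = 0.
Proof.
move=> miny.
have yI : y \in `]y - 1, y + 1[ by rewrite in_itv /= ltrBlDr ltrDl ltr01.
have der0 : is_derive y 1 (horner p) 0.
  apply: derive1_at_min yI _ => [|t _|t _]; [lra | exact: derivable_horner |].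
  exact: miny.
by rewrite -[LHS](@derive_val _ _ _ _ _ _ _ (is_derive_poly p y)) derive_val.
Qed.

(** * Tensors applied to a vector, rewritten as sums over edges *)

Lemma degree_tensor_apply (R : realType) (k n : nat) (E : {set {set 'I_n}})
    (x : 'rV[R]_n) (i : 'I_n) :
  tensor_apply (degree_tensor R k E) x 0 i = (degree E i)%:R * x 0 i ^+ k.-1.
Proof.
rewrite mxE (bigD1 (nseq_tuple k.-1 i)) //= [X in _ + X]big1 ?addr0 => [|t nt].
  by rewrite /degree_tensor all_pred1_nseq big_nseq iter_mulr_1.
rewrite /degree_tensor ifN ?mul0r //; apply: contra nt => /all_pred1P tE.
by apply/eqP/val_inj; rewrite /= tE size_tuple.
Qed.

(** A list of length #|A| covers [A] only if it has no repetition. Hence the tuples that index an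
    edge through [i] are the orderings of its other vertices. *)
Lemma set_cons_eqP (T : finType) (A : {set T}) (i : T) (t : seq T) :
    i \in A -> #|A| = (size t).+1 ->
  ([set j in i :: t] == A)%SET = all (mem (A :\ i)%SET) t && uniq t.
Proof.
move=> iA cA; apply/eqP/andP => [AE|[/allP tA ut]].
  have : uniq (i :: t).
    by apply/card_uniqP; rewrite -[RHS]cA -AE cardsE.
  move=> /= /andP[nit ut]; split=> //; apply/allP => j jt.
  by rewrite !inE -AE !inE jt orbT andbT; apply: contraNneq nit => <-.
have uit : uniq (i :: t).
  by rewrite /= ut andbT; apply/negP => /tA; rewrite !inE eqxx.
apply/eqP; rewrite eqEcard; apply/andP; split.
  by apply/fintype.subsetP => j; rewrite !inE => /orP[/eqP ->|/tA /[!inE] /andP[]].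
by rewrite cA cardsE (card_uniqP uit).
Qed.

(** Group the tuples by the edge they span with [i]: each edge arises from (k-1)! orderings, which
    cancels the entry 1/(k-1)!. *)
Lemma adjacency_tensor_apply (R : realType) (k n : nat) (E : {set {set 'I_n}})
    (x : 'rV[R]_n) (i : 'I_n) :
    (0 < k)%N -> (forall e : {set 'I_n}, e \in E -> #|e| = k) ->
  tensor_apply (adjacency_tensor R k E) x 0 i =
  \sum_(e in E | i \in e) \prod_(j in (e :\ i)%SET) x 0 j.
Proof.
move=> k0 cE; rewrite mxE.
pose img (t : k.-1.-tuple 'I_n) := [set j in i :: t]%SET.
rewrite (bigID (fun t => img t \in E)) /= [X in _ + X]big1 ?addr0; last first.
  by move=> t /negPf nE; rewrite /adjacency_tensor -/(img t) nE mul0r.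
rewrite (partition_big img (fun e => (e \in E) && (i \in e))) /=; last first.
  by move=> t tE; rewrite tE !inE eqxx.
apply: eq_bigr => e /andP[eE ie].
have ce (t : k.-1.-tuple 'I_n) : #|e| = (size t).+1.
  by rewrite size_tuple prednK // cE.
have cei : #|(e :\ i)%SET| = k.-1 by rewrite -(cE e eE) (cardsD1 i e) ie.
rewrite (eq_bigl [in [set t : k.-1.-tuple 'I_n |
    all (mem (e :\ i)%SET) t & uniq t]%SET]); last first.
  move=> t; rewrite inE -(set_cons_eqP ie (ce t)) -/(img t).
  by case: eqP => [->|]; rewrite ?eE // andbF.
rewrite (eq_bigr (fun=> (k.-1`!)%:R^-1 * \prod_(j in (e :\ i)%SET) x 0 j)).
  rewrite sumr_const card_uniq_tuples cei ffactnn -mulrnAl -[X in X *+ _]mul1r.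
  by rewrite -mulrnAl divff ?mul1r // pnatr_eq0 -lt0n fact_gt0.
move=> t /[!inE] tP; rewrite /adjacency_tensor -/(img t).
have /eqP -> : img t == e by rewrite set_cons_eqP.
rewrite eE; congr (_ * _); case/andP: tP => /allP te ut.
rewrite big_uniq //; apply: eq_bigl => j; apply: esym.
have ct : #|t| = #|(e :\ i)%SET| by rewrite cei (card_uniqP ut) size_tuple.
by rewrite (subset_cardP ct _ j) //; apply/fintype.subsetP => l /te.
Qed.
Lemma mulr_degree (R : realType) (n : nat) (E : {set {set 'I_n}}) (i : 'I_n) (c : R) :
  (degree E i)%:R * c = \sum_(e in E | i \in e) c.
Proof.
rewrite sumr_const mulr_natl; congr (_ *+ _).
by apply: eq_card => e; rewrite !inE.
Qed.

Lemma laplacian_tensor_apply (R : realType) (k n : nat) (E : {set {set 'I_n}})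
    (x : 'rV[R]_n) (i : 'I_n) :
    (0 < k)%N -> (forall e : {set 'I_n}, e \in E -> #|e| = k) ->
  tensor_apply (laplacian_tensor R k E) x 0 i =
  \sum_(e in E | i \in e) (x 0 i ^+ k.-1 - \prod_(j in (e :\ i)%SET) x 0 j).
Proof.
move=> k0 cE; rewrite sumrB -mulr_degree -degree_tensor_apply.
rewrite -(adjacency_tensor_apply x i k0 cE) !mxE -sumrB.
by apply: eq_bigr => t _; rewrite -mulrBl.
Qed.

Lemma laplacian_formE (R : realType) (k n : nat) (E : {set {set 'I_n}})
    (x : 'rV[R]_n) :
    (0 < k)%N -> (forall e : {set 'I_n}, e \in E -> #|e| = k) ->
  \sum_i x 0 i * tensor_apply (laplacian_tensor R k E) x 0 i =
  laplacian_form k E x.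
Proof.
move=> k0 cE.
under eq_bigr do rewrite laplacian_tensor_apply // mulr_sumr.
rewrite (exchange_big_dep [in E]) /= => [|i e _ /andP[]//].
(* The factor [k] is the size of [e]: each vertex of the edge supplies one copy of the product. *)
apply: eq_bigr => e eE; rewrite -[k in k%:R](cE e eE) mulr_natl -sumr_const -sumrB.
apply: eq_big => [i|i ie]; first by rewrite eE.
by case/andP: ie => _ ie; rewrite mulrBr -exprS prednK // -(big_setD1 i ie).
Qed.

Lemma H_eigenvalue_form (R : realType) (k n : nat) (E : {set {set 'I_n}})
    (x : 'rV[R]_n) (lam : R) :
    (0 < k)%N -> (forall e : {set 'I_n}, e \in E -> #|e| = k) ->
    (forall i, tensor_apply (laplacian_tensor R k E) x 0 i =
       lam * x 0 i ^+ k.-1) ->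
  laplacian_form k E x = lam * power_sum k x.
Proof.
move=> k0 cE eigx; rewrite -laplacian_formE // mulr_sumr.
by apply: eq_bigr => i _; rewrite eigx mulrCA -exprS prednK.
Qed.

(** * Variation of a single coordinate and the eigenvalue equation *)

Definition update_coord (R : realType) (n : nat) (x : 'rV[R]_n) (i : 'I_n)
    (s : R) : 'rV[R]_n := \row_j (if j == i then s else x 0 j).

Lemma power_sum_update (R : realType) (k n : nat) (x : 'rV[R]_n) (i : 'I_n)
    (s : R) :
  power_sum k (update_coord x i s) = power_sum k x + (s ^+ k - x 0 i ^+ k).
Proof.
rewrite /power_sum (bigD1 i) //= [in RHS](bigD1 i) //= mxE eqxx.
rewrite (eq_bigr (fun j => x 0 j ^+ k)) => [|j /negPf ji]; first by ring.
by rewrite mxE ji.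
Qed.

Lemma laplacian_form_update (R : realType) (k n : nat) (E : {set {set 'I_n}})
    (x : 'rV[R]_n) (i : 'I_n) (s : R) :
  laplacian_form k E (update_coord x i s) =
  laplacian_form k E x + \sum_(e in E | i \in e)
    (s ^+ k - x 0 i ^+ k
     - k%:R * (s - x 0 i) * \prod_(j in (e :\ i)%SET) x 0 j).
Proof.
pose P (e : {set 'I_n}) := i \in e.
rewrite /laplacian_form (bigID P) [X in _ = X + _](bigID P) /= {}/P.
have -> : \sum_(e in E | i \notin e) (\sum_(j in e) update_coord x i s 0 j ^+ k
    - k%:R * \prod_(j in e) update_coord x i s 0 j) =
    \sum_(e in E | i \notin e)
      (\sum_(j in e) x 0 j ^+ k - k%:R * \prod_(j in e) x 0 j).
  apply: eq_bigr => e /andP[_ ie].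
  have xE j : j \in e -> update_coord x i s 0 j = x 0 j.
    by move=> je; rewrite mxE ifN //; apply: contraNneq ie => <-.
  by congr (_ - _ * _); apply: eq_bigr => j /xE ->.
rewrite addrAC -big_split /=; congr (_ + _).
apply: eq_bigr => e /andP[_ ie].
rewrite !(big_setD1 i ie) /= mxE eqxx.
have xE j : j \in (e :\ i)%SET -> update_coord x i s 0 j = x 0 j.
  by rewrite !inE mxE => /andP[/negPf ->].
rewrite (eq_bigr (fun j => x 0 j ^+ k)) => [|j /xE -> //].
rewrite (eq_bigr (fun j => x 0 j)) => [|j /xE -> //].
by ring.
Qed.

(** The nonnegative quantity M * [power_sum] - [laplacian_form] vanishes at [x], so it is minimal
    there in each coordinate separately. One-variable calculus then suffices: the derivative in
    coordinate i is k times the i-th eigenvalue equation. *)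
Lemma max_eigenvector (R : realType) (k n : nat) (E : {set {set 'I_n}})
    (x : 'rV[R]_n) (M : R) :
    (0 < k)%N -> (forall e : {set 'I_n}, e \in E -> #|e| = k) ->
    (forall y : 'rV[R]_n, laplacian_form k E y <= M * power_sum k y) ->
    laplacian_form k E x = M * power_sum k x ->
  forall i, tensor_apply (laplacian_tensor R k E) x 0 i = M * x 0 i ^+ k.-1.
Proof.
move=> k0 cE maxM xM i; rewrite laplacian_tensor_apply // sumrB -mulr_degree.
set c : R := \sum_(e in E | _) _.
(* Up to an additive constant, [p] is M * [power_sum] - [laplacian_form] as a function of coordinate
   [i]: every edge is affine in x_i apart from x_i^k. *)
pose p : {poly R} := (M - (degree E i)%:R) *: 'X^k + (k%:R * c) *: 'X.
have pmin s : p.[x 0 i] <= p.[s].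
  rewrite -subr_ge0; have := maxM (update_coord x i s).
  rewrite laplacian_form_update power_sum_update xM !sumrB -!mulr_degree -mulr_sumr.
  rewrite -/c => maxs; rewrite /p !hornerE; lra.
have := deriv_at_min pmin.
rewrite /p derivD !derivZ derivXn derivX !(hornerE, hornerMn) => dp.
have kR : k%:R != 0 :> R by rewrite pnatr_eq0 -lt0n.
apply/eqP; rewrite -subr_eq0; apply/eqP/(mulfI kR).
rewrite mulr0; apply/eqP; rewrite -oppr_eq0; apply/eqP; rewrite -[RHS]dp; ring.
Qed.

(** * Existence of the maximum and of the largest H-eigenvalue *)

Lemma power_sum_gt0 (R : realType) (k n : nat) (x : 'rV[R]_n) :
  ~~ odd k -> x != 0 -> 0 < power_sum k x.
Proof.
move=> ek /rV0Pn[i xi]; rewrite lt_def sumr_ge0 ?andbT; last first.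
  by move=> j _; exact: exprn_even_ge0.
rewrite psumr_neq0 => [|j _]; last exact: exprn_even_ge0.
by apply/hasP; exists i; rewrite ?mem_index_enum // exprn_even_gt0 // xi orbT.
Qed.

Lemma power_sumZ (R : realType) (k n : nat) (c : R) (x : 'rV[R]_n) :
  power_sum k (c *: x) = c ^+ k * power_sum k x.
Proof. by rewrite mulr_sumr; apply: eq_bigr => i _; rewrite mxE exprMn. Qed.

Lemma laplacian_formZ (R : realType) (k n : nat) (E : {set {set 'I_n}})
    (c : R) (x : 'rV[R]_n) :
    (forall e : {set 'I_n}, e \in E -> #|e| = k) ->
  laplacian_form k E (c *: x) = c ^+ k * laplacian_form k E x.
Proof.
move=> cE; rewrite mulr_sumr; apply: eq_bigr => e eE.
rewrite mulrBr mulr_sumr mulrCA; congr (_ - _ * _).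
  by apply: eq_bigr => i _; rewrite mxE exprMn.
under eq_bigr do rewrite mxE.
by rewrite big_split /= prodr_const cE.
Qed.

Lemma sum_coord_pow_continuous (R : realType) (k n : nat) (P : pred 'I_n) :
  continuous (fun x : 'rV[R]_n => \sum_(i | P i) x 0 i ^+ k).
Proof.
apply: (continuous_big (@add_continuous R)) => i _ x.
apply: (@continuous_comp _ _ _ (fun y : 'rV[R]_n => y 0 i) (fun s => s ^+ k)).
  exact: coord_continuous.
exact: exprn_continuous.
Qed.

Lemma laplacian_form_continuous (R : realType) (k n : nat)
    (E : {set {set 'I_n}}) :
  continuous (@laplacian_form R k n E).
Proof.
apply: (continuous_big (@add_continuous R)) => e _ x.
have sum_cont := @sum_coord_pow_continuous R k n (mem e) x.
have prod_cont : continuous (fun y : 'rV[R]_n => \prod_(i in e) y 0 i).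
  by apply: (continuous_big (@mul_continuous R)) => i _; exact: coord_continuous.
exact: (cvgB sum_cont (cvgM (cvg_cst _) (prod_cont x))).
Qed.

Lemma unit_sphere_compact (R : realType) (n : nat) :
  compact [set x : 'rV[R]_n | `|x| = 1]%classic.
Proof.
apply: bounded_closed_compact.
  exists 1; split=> [|M M1 x /= ->]; [exact: real1 | exact: ltW].
apply: (@preimage_closed _ _ (fun x : 'rV[R]_n => `|x|) [set 1]%classic).
  by move=> x _; exact: norm_continuous.
exact: closed_eq.
Qed.

(* The quotient of the two forms is invariant under scaling, so its maximum over
   the sphere of the sup norm is a global maximum. *)
Lemma laplacian_form_max (R : realType) (k n : nat) (E : {set {set 'I_n}}) :
    (0 < n)%N -> ~~ odd k -> (0 < k)%N ->
    (forall e : {set 'I_n}, e \in E -> #|e| = k) ->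
  exists M : R, exists2 x : 'rV[R]_n,
    x != 0 & laplacian_form k E x = M * power_sum k x /\
    forall y : 'rV[R]_n, laplacian_form k E y <= M * power_sum k y.
Proof.
move=> n0 ek k0 cE.
pose A := [set x : 'rV[R]_n | `|x| = 1]%classic.
pose g (x : 'rV[R]_n) := laplacian_form k E x / power_sum k x.
have A_neq0 x : A x -> x != 0.
  by move=> Ax; rewrite -normr_eq0 Ax oner_neq0.
have normA (x : 'rV[R]_n) : x != 0 -> A (`|x|^-1 *: x).
  by move=> x0; rewrite /A /= normrZ normfV normr_id mulVf // normr_eq0.
have A0 : (A !=set0)%classic.
  exists (`|const_mx 1 : 'rV[R]_n|^-1 *: const_mx 1); apply: normA.
  by apply/rV0Pn; exists (Ordinal n0); rewrite mxE oner_neq0.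
have cg : {within A, continuous g}%classic.
  apply: continuous_in_subspaceT => x /[!inE] /A_neq0 x0.
  have sx : power_sum k x != 0 by rewrite gt_eqF // power_sum_gt0.
  exact: (cvgM (@laplacian_form_continuous R k n E x)
    (cvgV sx (@sum_coord_pow_continuous R k n predT x))).
have [x /[!inE] /A_neq0 x0 xmax] := EVT_max_rV A0 (@unit_sphere_compact R n) cg.
have gE y : y != 0 -> laplacian_form k E y = g y * power_sum k y.
  by move=> y0; rewrite divfK // gt_eqF // power_sum_gt0.
exists (g x), x => //; split=> [|y]; first exact: gE.
have [->|y0] := eqVneq y 0.
  rewrite -(scale0r y) laplacian_formZ // power_sumZ expr0n gtn_eqF //.
  by rewrite !mul0r mulr0.
rewrite gE // ler_wpM2r ?(ltW (power_sum_gt0 _ _)) //.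
suff -> : g y = g (`|y|^-1 *: y) by apply: xmax; rewrite inE; exact: normA.
rewrite /g laplacian_formZ // power_sumZ -mulf_div divff ?mul1r //.
by rewrite expf_neq0 // invr_neq0 // normr_eq0.
Qed.

(** The maximum M of the quotient is an H-eigenvalue, and any eigenpair realises its eigenvalue as a
    value of the quotient, so M is the largest one. The default value of [largest_H_eigenvalue] is
    thus never taken, and any nonzero vector gives a lower bound. *)
Lemma largest_H_eigenvalue_ge (R : realType) (k n : nat) (E : {set {set 'I_n}})
    (x : 'rV[R]_n) (mu : R) :
    ~~ odd k -> (0 < k)%N -> (forall e : {set 'I_n}, e \in E -> #|e| = k) ->
    x != 0 -> mu * power_sum k x <= laplacian_form k E x ->
  mu <= largest_H_eigenvalue (laplacian_tensor R k E).
Proof.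
move=> ek k0 cE x0 mux.
have n0 : (0 < n)%N by case/rV0Pn: x0 => i _; exact: leq_trans (ltn_ord i).
have [M [v v0 [vM maxM]]] := laplacian_form_max R n0 ek k0 cE.
rewrite (@largest_H_eigenvalueE _ _ _ _ M).
  rewrite -(ler_pM2r (power_sum_gt0 ek x0)); exact: le_trans (maxM x).
split; first by exists v => //; exact: max_eigenvector.
move=> lam [y y0 eigy].
by rewrite -(ler_pM2r (power_sum_gt0 ek y0)) -(H_eigenvalue_form k0 cE eigy).
Qed.

(** * The star test vector and the root of its equation *)

Lemma star_vector_bound (R : realType) (k n : nat) (E : {set {set 'I_n}})
    (s : 'I_n) (mu : R) :
    ~~ odd k -> (0 < k)%N -> (forall e : {set 'I_n}, e \in E -> #|e| = k) ->
    1 < mu -> (mu - 1) ^+ k.-1 * (mu - (degree E s)%:R) = (degree E s)%:R ->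
  exists2 x : 'rV[R]_n, x != 0 & mu * power_sum k x <= laplacian_form k E x.
Proof.
move=> ek k0 cE mu1 muE.
pose nbr j := [exists e in E, (s \in e) && (j \in e)].
pose x : 'rV[R]_n := \row_j (if j == s then 1 - mu else (nbr j)%:R).
have xs : x 0 s = 1 - mu by rewrite mxE eqxx.
have xn j : j != s -> x 0 j = (nbr j)%:R by move=> /negPf js; rewrite mxE js.
have xsk : (1 - mu) ^+ k = (mu - 1) ^+ k.
  by rewrite -opprB exprNn -signr_odd (negPf ek) mul1r.
exists x; first by apply/rV0Pn; exists s; rewrite xs; apply/eqP; lra.
set a := (mu - 1) ^+ k.
have card_del (e : {set 'I_n}) : e \in E -> s \in e -> #|(e :\ s)%SET| = k.-1.
  by move=> eE se; rewrite -(cE e eE) (cardsD1 s e) se.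
have boolX (b : bool) : b%:R ^+ k = b%:R :> R.
  by case: b; rewrite ?expr1n // expr0n gtn_eqF.
(* The centre carries the only negative coordinate, so the product over the edge is 1 - mu and
   enters with a positive sign. *)
have star_edge e : e \in E -> s \in e ->
    \sum_(i in e) x 0 i ^+ k - k%:R * \prod_(i in e) x 0 i =
    a + k.-1%:R + k%:R * (mu - 1).
  move=> eE se; rewrite !(big_setD1 s se) /= xs xsk -/a.
  have x1 i : i \in (e :\ s)%SET -> x 0 i = 1.
    rewrite !inE => /andP[/xn -> ie]; suff -> : nbr i by [].
    by apply/exists_inP; exists e => //; rewrite se.
  rewrite (eq_bigr (fun=> 1)) => [|i /x1 ->]; last by rewrite expr1n.
  rewrite [X in _ * (_ * X)]big1 => [|i /x1 -> //].
  have -> : \sum_(i in (e :\ s)%SET) (1 : R) = k.-1%:R.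
    by rewrite sumr_const (card_del e eE se).
  by ring.
(* Away from [s] the coordinates are 0 or 1, so x_i^k = x_i is at least the product over the edge,
   for each of its [k] vertices. *)
have other_edge e : e \in E -> s \notin e ->
    0 <= \sum_(i in e) x 0 i ^+ k - k%:R * \prod_(i in e) x 0 i.
  move=> eE se; rewrite -{2}(cE e eE) mulr_natl -sumr_const -sumrB.
  apply: sumr_ge0 => i ie.
  have xe j : j \in e -> x 0 j = (nbr j)%:R.
    by move=> je; apply: xn; apply: contraNneq se => <-.
  rewrite (big_setD1 i ie) /= xe // boolX subr_ge0 ler_piMr //.
  have xe1 j : j \in (e :\ i)%SET -> 0 <= x 0 j <= 1.
    by rewrite !inE => /andP[_ /xe ->]; rewrite ler0n lern1 leq_b1.
  exact: prodr_ile1.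
have form_ge : (degree E s)%:R * (a + k.-1%:R + k%:R * (mu - 1))
    <= laplacian_form k E x.
  rewrite mulr_degree /laplacian_form [leRHS](bigID (fun e : {set 'I_n} => s \in e)) /=.
  rewrite ler_wpDr //; first by apply: sumr_ge0 => e /andP[/other_edge].
  by apply: ler_sum => e /andP[/star_edge eE /eE ->].
(* Count neighbours through their incidences with edges at [s]; a neighbour lying in several such
   edges is counted several times, whence an inequality. *)
have sum_le : power_sum k x <= a + (degree E s)%:R * k.-1%:R.
  rewrite /power_sum (bigD1 s) //= xs xsk -/a lerD2l mulr_degree.
  have -> : \sum_(e in E | s \in e) k.-1%:R =
      \sum_(i | i != s) \sum_(e in E | (s \in e) && (i \in e)) (1 : R).
    rewrite (exchange_big_dep (fun e : {set 'I_n} => (e \in E) && (s \in e))) /=.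
      apply: eq_bigr => e /andP[eE se].
      rewrite -(card_del e eE se) -sumr_const.
      by apply: eq_bigl => i; rewrite !inE eE se.
    by move=> i e _ /and3P[-> -> _].
  apply: ler_sum => i /xn ->; rewrite boolX /nbr.
  case: exists_inP => [[e eE sie]|_]; last exact: sumr_ge0.
  by rewrite (bigD1 e) /= ?eE // ler_wpDr // sumr_ge0.
apply: le_trans form_ge; apply: le_trans (ler_wpM2l _ sum_le) _; first by lra.
move: muE; rewrite /a; move: (degree E s)%:R => d.
case: k k0 {ek cE xsk a card_del boolX star_edge other_edge sum_le} => // m _ /= muE.
rewrite exprS -subr_ge0.
(* The two bounds meet exactly: their difference is a multiple of the equation satisfied by mu. *)
suff -> : d * ((mu - 1) * (mu - 1) ^+ m + m%:R + m.+1%:R * (mu - 1)) -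
   mu * ((mu - 1) * (mu - 1) ^+ m + d * m%:R) =
   (mu - 1) * (d - (mu - 1) ^+ m * (mu - d)).
  by rewrite muE subrr mulr0.
rewrite -[m.+1%:R]natr1; ring.
Qed.

(** As [m] is odd, the equation reads (l-1)^m (l-d) = d. For l > d the left side is strictly
    increasing; it is 0 at d and d^m >= d at d+1, so the intermediate value theorem gives the root
    and monotonicity its uniqueness. *)
Lemma star_equation_root (R : realType) (m d : nat) :
    ~~ odd m.+1 -> (0 < d)%N -> (1 < m)%N ->
  exists mu : R, unique (fun l : R =>
      [/\ d%:R < l, l < d%:R + 1 ?<= if (d == 1%N)
        & (1 - l) ^+ m * (l - d%:R) + d%:R = 0]) mu.
Proof.
move=> em d0 m1.
have oppE (l : R) : (1 - l) ^+ m = - (l - 1) ^+ m.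
  by rewrite -opprB exprNn -signr_odd; move: em => /= /negPn ->; rewrite mulN1r.
have d1 : 1 <= d%:R :> R by rewrite ler1n.
pose p : {poly R} := ('X - 1) ^+ m * ('X - d%:R%:P) - d%:R%:P.
have pE l : p.[l] = (l - 1) ^+ m * (l - d%:R) - d%:R.
  by rewrite /p !(hornerE, horner_exp).
have incr (l l' : R) : d%:R < l -> l < l' -> p.[l] < p.[l'].
  move=> dl ll'; rewrite !pE ltrD2r ltr_pM //; try lra.
  - by rewrite exprn_ge0 //; lra.
  - by rewrite ltrXn2r ?gtn_eqF ?(ltnW m1) //; lra.
have dd : d%:R <= d%:R ^+ m :> R by rewrite -[leLHS]expr1 ler_weXn2l // ltnW.
have pd : p.[d%:R] = - d%:R by rewrite pE subrr mulr0 add0r.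
have pd1 : p.[d%:R + 1] = d%:R ^+ m - d%:R.
  by rewrite pE addrK addrAC subrr add0r mulr1.
have [|/=|mu /andP[dmu mud] /rootP pmu] := @poly_ivt R p d%:R (d%:R + 1).
- by rewrite lerDl.
- by rewrite pd pd1 oppr_le0 ler0n subr_ge0 dd.
have dlt : d%:R < mu.
  rewrite lt_neqAle dmu andbT; apply/eqP => dE; move: pmu; rewrite -dE pd.
  by lra.
exists mu; split=> [|l [dl _ lE]].
  split=> //; last by move: pmu; rewrite pE oppE => pmu; lra.
  (* A root at the right end d+1 would force d^m = d, which with m > 1 and d > 0 means d = 1. *)
  rewrite /Order.lteif; case: eqP => // /eqP dn1; rewrite lt_neqAle mud andbT.
  apply: contraNneq dn1 => muE; move: pmu; rewrite muE pd1 => /eqP.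
  rewrite subr_eq0 -natrX eqr_nat -[X in _ == X]expn1.
  move: d0; rewrite leq_eqVlt => /predU1P[<- //|dgt1].
  by rewrite eqn_exp2l // gtn_eqF.
have pl : p.[l] = 0 by rewrite pE; move: lE; rewrite oppE => lE; lra.
by apply/eqP; case: ltgtP => // [/(incr _ _ dlt)|/(incr _ _ dl)];
  rewrite pl pmu ltxx.
Qed.

(* For d = 1 the equation reads (lam - 1)^k = 1 and its only root above d is    *)
(* d + 1 = 2, so the interval is taken closed on the right in that case; for    *)
(* d >= 2 it is the open interval (d, d + 1).                                   *)
Theorem theorem3p2 (R : realType) (k n d : nat) (E : {set {set 'I_n}})
    (hk3 : (3 <= k)%N) (hkn : (k <= n)%N) (hk : ~~ odd k)
    (hE : uniform_hypergraph k E)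
    (hd : max_degree E = d) (hd0 : (0 < d)%N) :
  exists mu : R,
    unique (fun l : R =>
      [/\ d%:R < l, l < d%:R + 1 ?<= if (d == 1%N)
        & (1 - l) ^+ k.-1 * (l - d%:R) + d%:R = 0]) mu
    /\ mu <= largest_H_eigenvalue (laplacian_tensor R k E).
Proof.
have k0 : (0 < k)%N by exact: ltn_trans hk3.
have n0 : (0 < n)%N by exact: leq_trans hkn.
have [_ cE] := hE.
have [s ds] : exists s, degree E s = d.
  have [|s sE] := @bigop.eq_bigmax _ (degree E); first by rewrite card_ord.
  by exists s; rewrite -hd -sE.
have ek : ~~ odd k.-1.+1 by rewrite prednK.
have k1 : (1 < k.-1)%N by rewrite -ltnS prednK.
have [mu muP] := star_equation_root R ek hd0 k1.
exists mu; split=> //; case: muP => -[dmu _ muE] _.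
have d1 : 1 <= d%:R :> R by rewrite ler1n.
have [||x x0 xmu] := @star_vector_bound R k n E s mu hk k0 cE; rewrite ?ds.
- exact: le_lt_trans dmu.
- move: muE; rewrite -opprB exprNn -signr_odd.
  have -> : odd k.-1 by move: ek => /= /negPn.
  by rewrite mulN1r => muE; lra.
exact: largest_H_eigenvalue_ge xmu.
Qed.
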